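(* Let $\epsilon$ be a positive integer. Let $\beta:\mathbb{Q}_+^5\to\mathbb{Q}_+^5$ be the bijection $\beta(a,b,c,d,e)=(b,c,\frac{ac+be}{d},a,e)$, and let $\varphi:\mathbb{Q}_+^5\to\mathbb{Q}_+^3$ be $$\varphi(a,b,c,d,e)=\Big(\frac{a^2+b^2+cd}{ab},\ \frac{c^2d+a^2c+b^2d+abe}{bcd},\ \frac{cd^2+a^2c+b^2d+abe}{acd}\Big).$$ Let $$S(3,4,4)=\varphi^{-1}(3,4,4)\cap\{P=(a,b,c,d,\epsilon)\in\mathbb{N}^5\mid P\equiv 0\pmod{\epsilon}\}.$$ Then $S(3,4,4)$ is the orbit of $(\epsilon,\epsilon,\epsilon,\epsilon,\epsilon)$ under the cyclic group $\langle\beta^3\rangle$: $$S(3,4,4)=\{\beta^{3n}(\epsilon,\epsilon,\epsilon,\epsilon,\epsilon)\mid n\in\mathbb{Z}\}.$$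
   Context: $\mathbb{N}$ denotes the positive integers and $\mathbb{Q}_+$ the positive rationals. For a vector $P$, $P\equiv 0\pmod{\epsilon}$ means every component of $P$ is divisible by $\epsilon$. *)

(* Defs.v *)
From mathcomp Require Import all_boot all_order all_algebra.
From mathcomp Require Import interval_inference.
From mathcomp Require Import classical_sets.
Set Implicit Arguments.
Unset Strict Implicit.
Unset Printing Implicit Defensive.
Import Order.TTheory GRing.Theory Num.Theory.
Local Open Scope classical_set_scope.
Local Open Scope ring_scope.

Definition Qpos : Type := {posnum rat}.
Definition Qpos3 : Type := (Qpos * Qpos * Qpos)%type.
Definition Qpos5 : Type := (Qpos * Qpos * Qpos * Qpos * Qpos)%type.

Definition beta (P : Qpos5) : Qpos5 :=
  let: (a, b, c, d, e) := P in
  (b, c, ((a%:num * c%:num + b%:num * e%:num) / d%:num)%:pos, a, e).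

Definition beta_inv (P : Qpos5) : Qpos5 :=
  let: (a, b, c, d, e) := P in
  (d, a, b, ((d%:num * b%:num + a%:num * e%:num) / c%:num)%:pos, e).

Lemma betaK : cancel beta beta_inv.
Proof.
move=> [[[[a b] c] d] e]; rewrite /beta /beta_inv; congr (_, _, _, _, _).
apply: val_inj => /=; rewrite invf_div mulrCA divff ?mulr1 //.
Qed.

Lemma beta_invK : cancel beta_inv beta.
Proof.
move=> [[[[a b] c] d] e]; rewrite /beta /beta_inv; congr (_, _, _, _, _).
apply: val_inj => /=; rewrite invf_div mulrCA divff ?mulr1 //.
Qed.

Lemma beta_bij : bijective beta.
Proof. exact: Bijective betaK beta_invK. Qed.

Definition beta_pow (m : int) : Qpos5 -> Qpos5 :=
  match m with
  | Posz k => iter k beta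
  | Negz k => iter k.+1 beta_inv (* Negz k is - (k + 1) *)
  end.

Definition phi (P : Qpos5) : Qpos3 :=
  let: (a, b, c, d, e) := P in
  (((a%:num ^+ 2 + b%:num ^+ 2 + c%:num * d%:num) / (a%:num * b%:num))%:pos,
   ((c%:num ^+ 2 * d%:num + a%:num ^+ 2 * c%:num + b%:num ^+ 2 * d%:num
     + a%:num * b%:num * e%:num) / (b%:num * c%:num * d%:num))%:pos,
   ((c%:num * d%:num ^+ 2 + a%:num ^+ 2 * c%:num + b%:num ^+ 2 * d%:num
     + a%:num * b%:num * e%:num) / (a%:num * c%:num * d%:num))%:pos).

Definition Npos : Type := {n : nat | (0 < n)%N}.

Definition Qpos_of_Npos (n : Npos) : Qpos :=
  PosNum (etrans (ltr0n rat (val n)) (valP n)).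

Definition S_set (eps : Npos) (t : Qpos3) : set Qpos5 :=
  phi @^-1` [set t] `&`
  [set P : Qpos5 | exists a b c d : Npos,
     P = (Qpos_of_Npos a, Qpos_of_Npos b, Qpos_of_Npos c, Qpos_of_Npos d,
          Qpos_of_Npos eps) /\
     all (fun x : Npos => val eps %| val x)%N [:: a; b; c; d; eps]].

Definition diag5 (x : Qpos) : Qpos5 := (x, x, x, x, x).

(* Main.v *)
(** On the fibre of [phi] over (3,4,4), the second and third equations give
    c - d = 4 (b - a); with this, a combination of the first two reads
    a b (4 a - c - 2 d - e) = 0. The fibre is thus a plane conic, and its points
    in S(3,4,4) are e (1+s+2t, 1+2s+t, 1+4s, 1+4t, 1) with s, t natural numbers
    such that s^2 + t^2 = 9 s t + s + t. In these coordinates [beta^3] is the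
    Vieta jump (s, t) -> (9 s + 1 - t, s), and Vieta descent leads to (0, 0). *)
Require Import Defs.
From mathcomp Require Import all_boot all_order all_algebra.
From mathcomp Require Import interval_inference classical_sets.
From mathcomp Require Import ring zify.
Import Order.TTheory GRing.Theory Num.Theory.
Local Open Scope classical_set_scope.
Local Open Scope ring_scope.

(** * Integer powers of [beta] *)

Lemma Qpos_neq0 (x : Qpos) : x%:num != 0.
Proof. by []. Qed.

Lemma beta_powS (m : int) (P : Qpos5) :
  beta_pow (m + 1) P = beta (beta_pow m P).
Proof.
case: m => [k|[|k]]; first by rewrite -PoszD addn1.
  by rewrite /= beta_invK.
by rewrite (_ : Negz k.+1 + 1 = Negz k) ?[RHS]/= ?beta_invK //; lia.
Qed.

Lemma beta_pow_add3 (m : int) (P : Qpos5) :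
  beta_pow (m + 3) P = iter 3 beta (beta_pow m P).
Proof.
by rewrite (_ : m + 3 = m + 1 + 1 + 1) ?beta_powS //; lia.
Qed.

(** Steps to smaller exponents are checked after one more [beta^3], so that [beta_inv] is never
    computed on conic points. *)
Lemma iter3_beta_inj : injective (iter 3 beta).
Proof. by move=> P Q /(can_inj betaK)/(can_inj betaK)/(can_inj betaK). Qed.

(** * Vieta jumping on the conic *)

Definition conic (s t : nat) : Prop := (s ^ 2 + t ^ 2 = 9 * s * t + s + t)%N.

Definition dilate (e : Qpos) (k : nat) : Qpos := (e%:num * k.+1%:R)%:pos.

Lemma dilate_num (e : Qpos) (k : nat) : (dilate e k)%:num = e%:num * (k%:R + 1).
Proof. by rewrite /= natr1. Qed.

Definition conic_point (e : Qpos) (s t : nat) : Qpos5 :=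
  (dilate e (s + 2 * t), dilate e (2 * s + t), dilate e (4 * s),
   dilate e (4 * t), e).

Lemma conic_rat (s t : nat) : conic s t ->
  s%:R ^+ 2 + t%:R ^+ 2 = 9 * s%:R * t%:R + s%:R + t%:R :> rat.
Proof. by move=> /(congr1 (fun n => n%:R : rat)); rewrite !(natrD, natrM, natrX). Qed.

Lemma conicC (s t : nat) : conic s t -> conic t s.
Proof. rewrite /conic; lia. Qed.

(* If t > 9 s + 1, the other root 9 s + 1 - t of the quadratic would be
   negative, whereas the product of the roots is s^2 - s >= 0. *)
Lemma conic_jump_ge0 (s t : nat) : conic s t -> (t <= 9 * s + 1)%N.
Proof. rewrite /conic; nia. Qed.

(** As a quadratic in t the equation has root sum 9 s + 1, so the new value is the other root; the
    equation being symmetric, the coordinates may be swapped. *)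
Lemma conic_jump (s t : nat) : conic s t -> conic (9 * s + 1 - t) s.
Proof.
move=> st; have := conic_jump_ge0 _ _ st; move: st; rewrite /conic => st le_t.
(* Naming the other root u replaces truncated subtraction by a linear relation. *)
have [u Du] : exists u, (9 * s + 1 = t + u)%N by exists (9 * s + 1 - t)%N; lia.
by rewrite Du addKn; nia.
Qed.

(** The two roots in s have product t^2 - t < s^2, so the root paired with s is smaller than s. *)
Lemma conic_descent (s t : nat) : conic s t -> (t < s)%N ->
  (9 * t + 1 - s < s)%N.
Proof.
move=> st lt_ts; have := conic_jump_ge0 _ _ (conicC _ _ st).
move: st; rewrite /conic => st le_s.
have [u Du] : exists u, (9 * t + 1 = s + u)%N by exists (9 * t + 1 - s)%N; lia.
by rewrite Du addKn; nia.
Qed.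

(** On the diagonal the equation becomes 7 s^2 + 2 s = 0. *)
Lemma conic_diag (s : nat) : conic s s -> s = 0%N.
Proof. rewrite /conic; nia. Qed.

Lemma beta3_conic_point (e : Qpos) (s t : nat) : conic s t ->
  iter 3 beta (conic_point e s t) = conic_point e (9 * s + 1 - t) s.
Proof.
move=> st; have le_t := conic_jump_ge0 _ _ st.
have := conic_rat _ _ st.
have [u Du] : exists u, (9 * s + 1 = t + u)%N by exists (9 * s + 1 - t)%N; lia.
rewrite Du addKn.
have {Du} : u%:R = 9 * s%:R + 1 - t%:R :> rat.
  by apply/(addrI t%:R); rewrite -natrD -Du natrD natrM; ring.
move=> Du H.
set A := s%:R : rat in Du H; set B := t%:R : rat in Du H.
have step (a b c d x : Qpos) : x%:num * d%:num = a%:num * c%:num + b%:num * e%:num ->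
    beta (a, b, c, d, e) = (b, c, x, a, e).
  move=> Dx; rewrite /beta; congr (_, _, _, _, _); apply: val_inj => /=.
  by rewrite -Dx mulfK.
(* Each identity below holds modulo the conic equation; k is its cofactor. *)
have relE (k l r : rat) :
    l - r = k * (A ^+ 2 + B ^+ 2 - (9 * A * B + A + B)) -> l = r.
  by rewrite H subrr mulr0 => /subr0_eq.
rewrite !iterS [iter 0 _ _]/= /conic_point.
move: (dilate e) (dilate_num e) => q q_num.
(* The three applications create, in turn, the first three coordinates of the conic point at (u, s);
   its fourth is the old third. *)
have -> : beta (q (s + 2 * t), q (2 * s + t), q (4 * s), q (4 * t), e)%N =
    (q (2 * s + t), q (4 * s), q (u + 2 * s), q (s + 2 * t), e)%N.
  apply: step; rewrite !q_num !(natrD, natrM) -/A -/B Du.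
  by apply: (relE (- 4 * e%:num ^+ 2)); ring.
have -> : beta (q (2 * s + t), q (4 * s), q (u + 2 * s), q (s + 2 * t), e)%N =
    (q (4 * s), q (u + 2 * s), q (2 * u + s), q (2 * s + t), e)%N.
  apply: step; rewrite !q_num !(natrD, natrM) -/A -/B Du.
  by apply: (relE (- 3 * e%:num ^+ 2)); ring.
apply: step; rewrite !q_num !(natrD, natrM) -/A -/B Du.
by apply: (relE (- 4 * e%:num ^+ 2)); ring.
Qed.

(** * The orbit of the diagonal point *)

Lemma conic_point_diag (e : Qpos) : conic_point e 0 0 = diag5 e.
Proof. by congr (_, _, _, _, _); apply: val_inj; rewrite /= mulr1. Qed.

Lemma beta_pow3S (m : int) (P : Qpos5) :
  beta_pow (3 * (m + 1)) P = iter 3 beta (beta_pow (3 * m) P).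
Proof. by rewrite mulrDr mulr1 beta_pow_add3. Qed.

Lemma orbit_conic_point (e : Qpos) (n : int) :
  exists s t, conic s t /\ beta_pow (3 * n) (diag5 e) = conic_point e s t.
Proof.
elim: n => [|n [s [t [st IH]]]|n [s [t [st IH]]]].
- by exists 0%N, 0%N; rewrite conic_point_diag.
- exists (9 * s + 1 - t)%N, s; split; first exact: conic_jump.
  by rewrite intS addrC beta_pow3S IH beta3_conic_point.
(* The preimage of (s, t) under the jump is (t, 9 t + 1 - s). *)
- have ts := conicC _ _ st; have le_s := conic_jump_ge0 _ _ ts.
  have tu := conicC _ _ (conic_jump _ _ ts).
  exists t, (9 * t + 1 - s)%N; split=> //; apply: iter3_beta_inj.
  rewrite -beta_pow3S (_ : - n.+1%:Z + 1 = - n%:Z) ?IH; last by lia.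
  by rewrite beta3_conic_point ?subKn.
Qed.

(** Strong induction on s + t: the larger coordinate is replaced by the other root, going forwards
    if s < t and backwards if t < s. *)
Lemma conic_point_orbit (e : Qpos) (s t : nat) : conic s t ->
  exists n : int, beta_pow (3 * n) (diag5 e) = conic_point e s t.
Proof.
have [k] := ubnP (s + t)%N; elim: k s t => // k IHk s t; rewrite ltnS => le_k st.
have [lt_st|lt_ts|eq_st] := ltngtP s t.
- have [||n Dn] := IHk (9 * s + 1 - t)%N s.
  + have := conic_descent _ _ (conicC _ _ st) lt_st; lia.
  + exact: conic_jump.
  exists (n - 1); apply: iter3_beta_inj.
  by rewrite -beta_pow3S subrK Dn beta3_conic_point.
- have ts := conicC _ _ st.
  have [||n Dn] := IHk t (9 * t + 1 - s)%N.
  + have := conic_descent _ _ st lt_ts; lia.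
  + exact/conicC/conic_jump.
  exists (n + 1); rewrite beta_pow3S Dn beta3_conic_point ?subKn //.
    exact: conic_jump_ge0.
  exact/conicC/conic_jump.
- exists 0; move: st; rewrite -eq_st => /conic_diag->.
  by rewrite conic_point_diag.
Qed.

(** * The fibre over (3,4,4) *)

Lemma phi_conic_point (e : Qpos) (s t : nat) : conic s t ->
  phi (conic_point e s t) = (3%:pos, 4%:pos, 4%:pos).
Proof.
move=> /conic_rat; set A := s%:R : rat; set B := t%:R : rat => H.
have relE (k l r : rat) :
    l - r = k * (A ^+ 2 + B ^+ 2 - (9 * A * B + A + B)) -> l = r.
  by rewrite H subrr mulr0 => /subr0_eq.
rewrite /conic_point.
move: (dilate e) (dilate_num e) => q q_num.
rewrite /phi; congr (_, _, _); apply: val_inj => /=;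
  apply: (canLR (mulfK _)); rewrite ?mulf_neq0 ?pnatr_eq0 ?Qpos_neq0 //;
  rewrite !q_num !(natrD, natrM) -/A -/B.
- by apply: (relE (- e%:num ^+ 2)); ring.
(* The last two equations share a cofactor: with denominators cleared they differ by c d (c - d - 4
   (b - a)), which vanishes identically on conic points. *)
- by apply: (relE (e%:num ^+ 3 * (4 * A + 4 * B + 3))); ring.
- by apply: (relE (e%:num ^+ 3 * (4 * A + 4 * B + 3))); ring.
Qed.

Lemma fibre344_plane (R : idomainType) (a b c d e : R) :
    a != 0 -> b != 0 -> c != 0 -> d != 0 ->
    a ^+ 2 + b ^+ 2 + c * d = 3 * (a * b) ->
    c ^+ 2 * d + a ^+ 2 * c + b ^+ 2 * d + a * b * e = 4 * (b * c * d) ->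
    c * d ^+ 2 + a ^+ 2 * c + b ^+ 2 * d + a * b * e = 4 * (a * c * d) ->
  4 * a = c + 2 * d + e /\ 4 * b = 2 * c + d + e.
Proof.
move=> a0 b0 c0 d0 E1 E2 E3.
have Dc : c = d + 4 * (b - a).
  apply/eqP; rewrite -subr_eq0; have: c * d * (c - (d + 4 * (b - a))) = 0.
    have -> : c * d * (c - (d + 4 * (b - a))) =
      (c ^+ 2 * d + a ^+ 2 * c + b ^+ 2 * d + a * b * e - 4 * (b * c * d)) -
      (c * d ^+ 2 + a ^+ 2 * c + b ^+ 2 * d + a * b * e - 4 * (a * c * d)).
      by ring.
    by rewrite E2 E3 !subrr.
  by move/eqP; rewrite !mulf_eq0 (negPf c0) (negPf d0).
have De : 4 * a = c + 2 * d + e.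
  apply/eqP; rewrite -subr_eq0.
  have: a * b * (4 * a - (c + 2 * d + e)) = 0.
    (* The multiplier d - 4 a is chosen so that, once c is eliminated, every term not divisible by a
       b cancels. *)
    have -> : a * b * (4 * a - (c + 2 * d + e)) =
      (d - 4 * a) * (a ^+ 2 + b ^+ 2 + c * d - 3 * (a * b)) -
      (c ^+ 2 * d + a ^+ 2 * c + b ^+ 2 * d + a * b * e - 4 * (b * c * d)).
      by rewrite Dc; ring.
    by rewrite E1 E2 !subrr mulr0 subr0.
  by move/eqP; rewrite !mulf_eq0 (negPf a0) (negPf b0).
have Db : 4 * b = 4 * a + c - d by rewrite Dc; ring.
by split=> //; rewrite Db De; ring.
Qed.

Lemma phi344_plane (a b c d e : Qpos) :
    phi (a, b, c, d, e) = (3%:pos, 4%:pos, 4%:pos) ->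
  [/\ a%:num ^+ 2 + b%:num ^+ 2 + c%:num * d%:num = 3 * (a%:num * b%:num),
      4 * a%:num = c%:num + 2 * d%:num + e%:num &
      4 * b%:num = 2 * c%:num + d%:num + e%:num].
Proof.
rewrite /phi => -[/(canRL (mulfVK _)) E1 /(canRL (mulfVK _)) E2 /(canRL (mulfVK _)) E3].
have {}E1 := E1 (mulf_neq0 (Qpos_neq0 a) (Qpos_neq0 b)).
have {}E2 := E2 (mulf_neq0 (mulf_neq0 (Qpos_neq0 b) (Qpos_neq0 c)) (Qpos_neq0 d)).
have {}E3 := E3 (mulf_neq0 (mulf_neq0 (Qpos_neq0 a) (Qpos_neq0 c)) (Qpos_neq0 d)).
have [||||Da Db] := fibre344_plane _ _ _ _ _ _ _ _ _ _ E1 E2 E3; first 4 last.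
  by split.
all: exact: Qpos_neq0.
Qed.

Lemma nat_conic_param (a b c d e : nat) : (0 < e)%N -> (0 < c)%N -> (0 < d)%N ->
    (e %| a)%N -> (e %| b)%N -> (e %| c)%N -> (e %| d)%N ->
    (a ^ 2 + b ^ 2 + c * d = 3 * (a * b))%N ->
    (4 * a = c + 2 * d + e)%N -> (4 * b = 2 * c + d + e)%N ->
  exists s t, conic s t /\
    [/\ a = e * (s + 2 * t).+1, b = e * (2 * s + t).+1,
       c = e * (4 * s).+1 & d = e * (4 * t).+1]%N.
Proof.
move=> e0 c0 d0 /dvdnP[a' Ea] /dvdnP[b' Eb] /dvdnP[c' Ec] /dvdnP[d' Ed].
move: c0 d0; rewrite {a}Ea {b}Eb {c}Ec {d}Ed !muln_gt0.
move=> /andP[c0 _] /andP[d0 _] E1 E2 E3.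
have {}E1 : (a' ^ 2 + b' ^ 2 + c' * d' = 3 * (a' * b'))%N.
  have ee0 : (0 < e * e)%N by rewrite muln_gt0 e0.
  by apply/eqP; rewrite -(eqn_pmul2l ee0); apply/eqP; lia.
have {}E2 : (4 * a' = c' + 2 * d' + 1)%N.
  by apply/eqP; rewrite -(eqn_pmul2l e0); apply/eqP; lia.
have {}E3 : (4 * b' = 2 * c' + d' + 1)%N.
  by apply/eqP; rewrite -(eqn_pmul2l e0); apply/eqP; lia.
(* Modulo 4, c' + 2 d' and 2 c' + d' are both -1, which forces c' and d' to be 1. *)
have Dc : c' = (4 * (c' %/ 4)).+1 by lia.
have Dd : d' = (4 * (d' %/ 4)).+1 by lia.
move: (c' %/ 4)%N (d' %/ 4)%N Dc Dd => s t Dc Dd.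
have Da : a' = (s + 2 * t).+1 by lia.
have Db : b' = (2 * s + t).+1 by lia.
exists s, t; rewrite Da Db Dc Dd ![(e * _)%N]mulnC; split=> //.
by move: E1; rewrite Da Db Dc Dd /conic; lia.
Qed.

Lemma S344_conic_point (eps : Npos) (P : Qpos5) :
  S_set eps (3%:pos, 4%:pos, 4%:pos) P <->
  exists s t, conic s t /\ P = conic_point (Qpos_of_Npos eps) s t.
Proof.
have numE (n : Npos) : (Qpos_of_Npos n)%:num = (sval n)%:R by [].
have e0 : (0 < sval eps)%N := valP eps.
split=> [[/= phiP [a [b [c [d [DP]]]]]]|[s [t [st ->]]]].
  rewrite /= andbT => /and5P[ea eb ec ed _].
  move: phiP; rewrite {P}DP => /phi344_plane[]; rewrite !numE => R1 R2 R3.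
  have [|||s [t [st [Da Db Dc Dd]]]] :=
    nat_conic_param _ _ _ _ _ e0 (valP c) (valP d) ea eb ec ed.
  (* The rational relations descend to natural numbers by injectivity of the embedding. *)
  - by apply/eqP; rewrite -(eqr_nat rat) !(natrD, natrM, natrX) R1.
  - by apply/eqP; rewrite -(eqr_nat rat) !(natrD, natrM) R2.
  - by apply/eqP; rewrite -(eqr_nat rat) !(natrD, natrM) R3.
  exists s, t; split=> //; congr (_, _, _, _, _); apply: val_inj => /=.
  + by rewrite Da natrM.
  + by rewrite Db natrM.
  + by rewrite Dc natrM.
  + by rewrite Dd natrM.
split; first exact: phi_conic_point.
have mulP k : (0 < sval eps * k.+1)%N by rewrite muln_gt0 e0.
exists (Sub _ (mulP (s + 2 * t)%N)), (Sub _ (mulP (2 * s + t)%N)),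
  (Sub _ (mulP (4 * s)%N)), (Sub _ (mulP (4 * t)%N)); split.
  by congr (_, _, _, _, _); apply: val_inj; rewrite /= natrM.
by rewrite /= !dvdn_mulr ?dvdnn.
Qed.

Theorem theorem4p4 (eps : Npos) :
  S_set eps (3%:pos, 4%:pos, 4%:pos) =
  [set beta_pow (3 * n) (diag5 (Qpos_of_Npos eps)) | n in [set: int]].
Proof.
apply/seteqP; split=> P.
  move=> /S344_conic_point[s [t [st ->]]].
  by have [n Dn] := conic_point_orbit (Qpos_of_Npos eps) _ _ st; exists n.
move=> [n _ <-]; apply/S344_conic_point.
exact: orbit_conic_point.
Qed.
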